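(* Let $W,X,Y,Z$ be objects of a symmetric semicartesian monoidal category $\mathsf{C}$ with unit $1$. Let $P:\mathsf{C}\to\mathsf{C}$ be a bimonoidal functor (with multiplication $\nabla$ and comultiplication $\Delta$), with $P(1)\cong 1$. Let $r:1\to P(W\otimes X)$ and $s:1\to P(Y\otimes Z)$ be morphisms, and consider the law $$r\otimes_\nabla s:=\nabla\circ(r\otimes s):1\cong 1\otimes 1\to P(W\otimes X\otimes Y\otimes Z).$$ Then after forgetting $X$ and $Z$, for the resulting law $1\to P(W\otimes Y)$ the objects $W$ and $Y$ are independent. Likewise, after forgetting $W$ and $Y$, for the resulting law $1\to P(X\otimes Z)$ the objects $X$ and $Z$ are independent.
   Context: A monoidal category is semicartesian if its unit $1$ is terminal; write $!:X\to 1$ for the unique map. A law on $X$ is a morphism $1\to PX$. Forgetting $X$ and $Z$ from a law on $W\otimes X\otimes Y\otimes Z$ means composing it with $P$ applied to $W\otimes X\otimes Y\otimes Z\xrightarrow{\mathrm{id}\otimes !\otimes\mathrm{id}\otimes !}W\otimes 1\otimes Y\otimes 1\cong W\otimes Y$; similarly for forgetting $W$ and $Y$. Independence: for a law $t:1\to P(A\otimes B)$, the objects $A$ and $B$ are independent for $t$ if and only if $\nabla_{A,B}\circ\Delta_{A,B}\circ t=t$. A bimonoidal (= bilax monoidal) endofunctor $P$ of a braided monoidal category is a functor with a lax monoidal structure $(\eta:1\to P(1),\ \nabla_{X,Y}:PX\otimes PY\to P(X\otimes Y))$ and an oplax monoidal structure $(\epsilon:P(1)\to 1,\ \Delta_{X,Y}:P(X\otimes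 Y)\to PX\otimes PY)$ such that: (i) for all $W,X,Y,Z$, $$\Delta_{W\otimes Y,X\otimes Z}\circ P(\mathrm{id}_W\otimes \beta_{X,Y}\otimes \mathrm{id}_Z)\circ\nabla_{W\otimes X,Y\otimes Z}=(\nabla_{W,Y}\otimes\nabla_{X,Z})\circ(\mathrm{id}\otimes\beta_{PX,PY}\otimes\mathrm{id})\circ(\Delta_{W,X}\otimes\Delta_{Y,Z})$$ as maps $P(W\otimes X)\otimes P(Y\otimes Z)\to P(W\otimes Y)\otimes P(X\otimes Z)$, where $\beta$ is the braiding and associators are suppressed; (ii) $\epsilon\circ\eta=\mathrm{id}_1$; the composite $1\xrightarrow{\eta}P(1)\cong P(1\otimes 1)\xrightarrow{\Delta_{1,1}}P(1)\otimes P(1)$ equals $1\cong 1\otimes 1\xrightarrow{\eta\otimes\eta}P(1)\otimes P(1)$; and $P(1)\otimes P(1)\xrightarrow{\nabla_{1,1}}P(1\otimes 1)\cong P(1)\xrightarrow{\epsilon}1$ equals $P(1)\otimes P(1)\xrightarrow{\epsilon\otimes\epsilon}1\otimes 1\cong 1$. *)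

(* Defs.v *)
Set Implicit Arguments.
Unset Strict Implicit.
Unset Printing Implicit Defensive.

Declare Scope cat_scope.
Delimit Scope cat_scope with cat.
Open Scope cat_scope.

Reserved Notation "X ~> Y" (at level 90, right associativity).
Reserved Notation "X ≅ Y" (at level 70, no associativity).
Reserved Notation "X ⊗ Y" (at level 40, left associativity).
Reserved Notation "f ⊗₁ g" (at level 40, left associativity).

Record category := Category {
  ob :> Type;
  hom : ob -> ob -> Type;
  idm : forall X, hom X X;
  comp : forall X Y Z, hom Y Z -> hom X Y -> hom X Z;
  comp_idl : forall X Y (f : hom X Y), comp (idm Y) f = f;
  comp_idr : forall X Y (f : hom X Y), comp f (idm X) = f;
  comp_assoc : forall X Y Z T (h : hom Z T) (g : hom Y Z) (f : hom X Y),
    comp h (comp g f) = comp (comp h g) f }.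

Arguments idm {c} X.

Notation "X ~> Y" := (hom X Y) : cat_scope.
Notation "g \o f" := (comp g f) (at level 50, left associativity) : cat_scope.

Record iso (C : category) (X Y : C) := Iso {
  fwd : X ~> Y;
  inv : Y ~> X;
  fwd_inv : fwd \o inv = idm Y;
  inv_fwd : inv \o fwd = idm X }.

Notation "X ≅ Y" := (iso X Y) : cat_scope.

Record monoidal_category := MonoidalCategory {
  mon_cat :> category;
  one : mon_cat;
  tens : mon_cat -> mon_cat -> mon_cat;
  tens_map : forall X X' Y Y' : mon_cat,
    (X ~> X') -> (Y ~> Y') -> (tens X Y ~> tens X' Y');
  tens_id : forall X Y : mon_cat, tens_map (idm X) (idm Y) = idm (tens X Y);
  tens_comp : forall (X X' X'' Y Y' Y'' : mon_cat)
      (f' : X' ~> X'') (f : X ~> X') (g' : Y' ~> Y'') (g : Y ~> Y'),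
    tens_map (f' \o f) (g' \o g) = tens_map f' g' \o tens_map f g;
  assoc : forall X Y Z : mon_cat, tens (tens X Y) Z ≅ tens X (tens Y Z);
  lunit : forall X : mon_cat, tens one X ≅ X;
  runit : forall X : mon_cat, tens X one ≅ X;
  assoc_nat : forall (X X' Y Y' Z Z' : mon_cat)
      (f : X ~> X') (g : Y ~> Y') (h : Z ~> Z'),
    fwd (assoc X' Y' Z') \o tens_map (tens_map f g) h
    = tens_map f (tens_map g h) \o fwd (assoc X Y Z);
  lunit_nat : forall (X X' : mon_cat) (f : X ~> X'),
    fwd (lunit X') \o tens_map (idm one) f = f \o fwd (lunit X);
  runit_nat : forall (X X' : mon_cat) (f : X ~> X'),
    fwd (runit X') \o tens_map f (idm one) = f \o fwd (runit X);
  pentagon : forall X Y Z T : mon_cat,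
    fwd (assoc X Y (tens Z T)) \o fwd (assoc (tens X Y) Z T)
    = tens_map (idm X) (fwd (assoc Y Z T)) \o fwd (assoc X (tens Y Z) T)
      \o tens_map (fwd (assoc X Y Z)) (idm T);
  triangle : forall X Y : mon_cat,
    tens_map (idm X) (fwd (lunit Y)) \o fwd (assoc X one Y)
    = tens_map (fwd (runit X)) (idm Y) }.

Arguments one {m}.

Notation "𝟙" := one : cat_scope.
Notation "X ⊗ Y" := (tens X Y) : cat_scope.
Notation "f ⊗₁ g" := (tens_map f g) : cat_scope.

Record braided_category := BraidedCategory {
  br_mon :> monoidal_category;
  braid : forall X Y : br_mon, X ⊗ Y ≅ Y ⊗ X;
  braid_nat : forall (X X' Y Y' : br_mon) (f : X ~> X') (g : Y ~> Y'),
    fwd (braid X' Y') \o (f ⊗₁ g) = (g ⊗₁ f) \o fwd (braid X Y);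
  hexagon : forall X Y Z : br_mon,
    fwd (assoc Y Z X) \o fwd (braid X (Y ⊗ Z)) \o fwd (assoc X Y Z)
    = (idm Y ⊗₁ fwd (braid X Z)) \o fwd (assoc Y X Z)
      \o (fwd (braid X Y) ⊗₁ idm Z);
  hexagon_inv : forall X Y Z : br_mon,
    inv (assoc Z X Y) \o fwd (braid (X ⊗ Y) Z) \o inv (assoc X Y Z)
    = (fwd (braid X Z) ⊗₁ idm Y) \o inv (assoc X Z Y)
      \o (idm X ⊗₁ fwd (braid Y Z)) }.

Record symmetric_category := SymmetricCategory {
  sym_br :> braided_category;
  braid_sym : forall X Y : sym_br,
    fwd (braid Y X) \o fwd (braid X Y) = idm (X ⊗ Y) }.

Record semicartesian (C : monoidal_category) := Semicartesian {
  bang : forall X : C, X ~> 𝟙;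
  bang_unique : forall (X : C) (f : X ~> 𝟙), f = bang X }.

(* [id ⊗ braid X Y ⊗ id], with the suppressed associators written out. *)
Definition interchange (C : braided_category) (W X Y Z : C) :
    (W ⊗ X) ⊗ (Y ⊗ Z) ~> (W ⊗ Y) ⊗ (X ⊗ Z) :=
  inv (assoc W Y (X ⊗ Z))
  \o (idm W ⊗₁ (fwd (assoc Y X Z)
                \o (fwd (braid X Y) ⊗₁ idm Z)
                \o inv (assoc X Y Z)))
  \o fwd (assoc W X (Y ⊗ Z)).

Record endofunctor (C : category) := Endofunctor {
  fob :> C -> C;
  fmap : forall X Y : C, (X ~> Y) -> (fob X ~> fob Y);
  fmap_id : forall X : C, fmap (idm X) = idm (fob X);
  fmap_comp : forall (X Y Z : C) (g : Y ~> Z) (f : X ~> Y),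
    fmap (g \o f) = fmap g \o fmap f }.

Arguments fmap {C} e {X Y} f.

Record lax_monoidal (C : monoidal_category) (P : endofunctor C) := LaxMonoidal {
  lax_eta : 𝟙 ~> P 𝟙;
  lax_nabla : forall X Y : C, P X ⊗ P Y ~> P (X ⊗ Y);
  nabla_nat : forall (X X' Y Y' : C) (f : X ~> X') (g : Y ~> Y'),
    lax_nabla X' Y' \o (fmap P f ⊗₁ fmap P g)
    = fmap P (f ⊗₁ g) \o lax_nabla X Y;
  nabla_assoc : forall X Y Z : C,
    fmap P (fwd (assoc X Y Z)) \o lax_nabla (X ⊗ Y) Z
      \o (lax_nabla X Y ⊗₁ idm (P Z))
    = lax_nabla X (Y ⊗ Z) \o (idm (P X) ⊗₁ lax_nabla Y Z)
      \o fwd (assoc (P X) (P Y) (P Z));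
  nabla_lunit : forall X : C,
    fmap P (fwd (lunit X)) \o lax_nabla 𝟙 X \o (lax_eta ⊗₁ idm (P X))
    = fwd (lunit (P X));
  nabla_runit : forall X : C,
    fmap P (fwd (runit X)) \o lax_nabla X 𝟙 \o (idm (P X) ⊗₁ lax_eta)
    = fwd (runit (P X)) }.

Record oplax_monoidal (C : monoidal_category) (P : endofunctor C) :=
  OplaxMonoidal {
  oplax_eps : P 𝟙 ~> 𝟙;
  oplax_delta : forall X Y : C, P (X ⊗ Y) ~> P X ⊗ P Y;
  delta_nat : forall (X X' Y Y' : C) (f : X ~> X') (g : Y ~> Y'),
    oplax_delta X' Y' \o fmap P (f ⊗₁ g)
    = (fmap P f ⊗₁ fmap P g) \o oplax_delta X Y;
  delta_assoc : forall X Y Z : C,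
    fwd (assoc (P X) (P Y) (P Z)) \o (oplax_delta X Y ⊗₁ idm (P Z))
      \o oplax_delta (X ⊗ Y) Z
    = (idm (P X) ⊗₁ oplax_delta Y Z) \o oplax_delta X (Y ⊗ Z)
      \o fmap P (fwd (assoc X Y Z));
  delta_lunit : forall X : C,
    fwd (lunit (P X)) \o (oplax_eps ⊗₁ idm (P X)) \o oplax_delta 𝟙 X
    = fmap P (fwd (lunit X));
  delta_runit : forall X : C,
    fwd (runit (P X)) \o (idm (P X) ⊗₁ oplax_eps) \o oplax_delta X 𝟙
    = fmap P (fwd (runit X)) }.

(* The isomorphism between [𝟙] and [𝟙 ⊗ 𝟙] is taken to be [lunit 𝟙],
   which coherence identifies with [runit 𝟙]. *)
Record bimonoidal_functor (C : braided_category) := BimonoidalFunctor {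
  bi_fun :> endofunctor C;
  bi_lax : lax_monoidal bi_fun;
  bi_oplax : oplax_monoidal bi_fun;
  eta := lax_eta bi_lax;
  nabla := lax_nabla bi_lax;
  eps := oplax_eps bi_oplax;
  delta := oplax_delta bi_oplax;
  delta_nabla : forall W X Y Z : C,
    delta (W ⊗ Y) (X ⊗ Z) \o fmap bi_fun (interchange W X Y Z)
      \o nabla (W ⊗ X) (Y ⊗ Z)
    = (nabla W Y ⊗₁ nabla X Z)
      \o interchange (bi_fun W) (bi_fun X) (bi_fun Y) (bi_fun Z)
      \o (delta W X ⊗₁ delta Y Z);
  eps_eta : eps \o eta = idm 𝟙;
  delta_eta :
    delta 𝟙 𝟙 \o fmap bi_fun (inv (lunit 𝟙)) \o eta
    = (eta ⊗₁ eta) \o inv (lunit 𝟙);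
  eps_nabla :
    eps \o fmap bi_fun (fwd (lunit 𝟙)) \o nabla 𝟙 𝟙
    = fwd (lunit 𝟙) \o (eps ⊗₁ eps) }.

Arguments nabla {C} b X Y.
Arguments delta {C} b X Y.

Definition law (C : monoidal_category) (P : endofunctor C) (X : C) : Type :=
  𝟙 ~> P X.

Definition independent (C : braided_category) (P : bimonoidal_functor C)
    (A B : C) (t : law P (A ⊗ B)) : Prop :=
  nabla P A B \o delta P A B \o t = t.

Definition law_tensor (C : braided_category) (P : bimonoidal_functor C)
    (A B : C) (r : law P A) (s : law P B) : law P (A ⊗ B) :=
  nabla P A B \o (r ⊗₁ s) \o inv (lunit 𝟙).

Arguments independent {C} P A B t.

(* The fourfold product is bracketed as [(W ⊗ X) ⊗ (Y ⊗ Z)], the codomain of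
   [nabla (W ⊗ X) (Y ⊗ Z)]. *)
Section Forget.
Variables (C : monoidal_category) (sc : semicartesian C) (P : endofunctor C).
Variables W X Y Z : C.

Definition forget_XZ (t : law P ((W ⊗ X) ⊗ (Y ⊗ Z))) : law P (W ⊗ Y) :=
  fmap P ((fwd (runit W) ⊗₁ fwd (runit Y))
          \o ((idm W ⊗₁ bang sc X) ⊗₁ (idm Y ⊗₁ bang sc Z))) \o t.

Definition forget_WY (t : law P ((W ⊗ X) ⊗ (Y ⊗ Z))) : law P (X ⊗ Z) :=
  fmap P ((fwd (lunit X) ⊗₁ fwd (lunit Z))
          \o ((bang sc W ⊗₁ idm X) ⊗₁ (bang sc Y ⊗₁ idm Z))) \o t.

End Forget.

(* Main.v *)
(** Since [P 𝟙] is isomorphic to the terminal object, [eta] and [eps] are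
    mutually inverse, and the braidings of [𝟙] and of [P 𝟙] with themselves
    are identities. Hence the bimonoid axiom (i) at [A, 𝟙, 𝟙, B], read through
    the unit laws of [nabla] and [delta], says [delta \o nabla = id] on
    [P A ⊗ P B]. So every law in the image of [nabla] is independent, and by
    naturality of [nabla] forgetting keeps a law in that image. *)

Require Import Defs.

Set Implicit Arguments.
Unset Strict Implicit.

Lemma tens_map_id_comp (C : monoidal_category) (A X Y Z : C)
    (g : Y ~> Z) (f : X ~> Y) :
  (idm A ⊗₁ g) \o (idm A ⊗₁ f) = idm A ⊗₁ (g \o f).
Proof. now rewrite <- tens_comp, comp_idl. Qed.

Lemma tens_map_comp_id (C : monoidal_category) (A X Y Z : C)
    (g : Y ~> Z) (f : X ~> Y) :
  (g ⊗₁ idm A) \o (f ⊗₁ idm A) = (g \o f) ⊗₁ idm A.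
Proof. now rewrite <- tens_comp, comp_idl. Qed.

(** Equal middle objects give the interchange the same source and target; once the braiding is
    trivial, the associators cancel in pairs. *)
Lemma interchange_id (C : braided_category) (A U B : C) :
  fwd (braid U U) = idm (U ⊗ U) ->
  interchange A U U B = idm ((A ⊗ U) ⊗ (U ⊗ B)).
Proof.
intros H; unfold interchange.
now rewrite H, tens_id, comp_idr, fwd_inv, tens_id, comp_idr, inv_fwd.
Qed.

Section Semicartesian.
Variables (C : monoidal_category) (sc : semicartesian C).

Lemma hom_to_unit_eq (X : C) (f g : X ~> 𝟙) : f = g.
Proof. now rewrite (bang_unique sc f), (bang_unique sc g). Qed.

Lemma hom_to_terminal_eq (U : C) (i : U ≅ 𝟙) (X : C) (f g : X ~> U) : f = g.
Proof.
rewrite <- (comp_idl f), <- (comp_idl g), <- (inv_fwd i), <- !comp_assoc.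
f_equal; apply hom_to_unit_eq.
Qed.

(** Makes maps into [U ⊗ U] unique, which forces [braid U U] to be the identity. *)
Definition tens_terminal (U V : C) (i : U ≅ 𝟙) (j : V ≅ 𝟙) : U ⊗ V ≅ 𝟙.
Proof.
refine {| fwd := fwd (lunit 𝟙) \o (fwd i ⊗₁ fwd j);
          inv := (inv i ⊗₁ inv j) \o inv (lunit 𝟙) |}.
- apply hom_to_unit_eq.
- rewrite <- comp_assoc, (comp_assoc (inv (lunit _))), inv_fwd, comp_idl.
  now rewrite <- tens_comp, !inv_fwd, tens_id.
Defined.

End Semicartesian.

Section BimonoidalFunctor.
Variables (C : braided_category) (sc : semicartesian C).
Variables (P : bimonoidal_functor C) (P1 : P 𝟙 ≅ 𝟙).

Lemma interchange_terminal (U : C) (i : U ≅ 𝟙) (A B : C) :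
  interchange A U U B = idm ((A ⊗ U) ⊗ (U ⊗ B)).
Proof.
apply interchange_id, (hom_to_terminal_eq sc (tens_terminal sc i i)).
Qed.

(** [P1] makes [P 𝟙] terminal; the axiom [eps_eta] only covers the opposite composite. *)
Lemma eta_eps : eta P \o eps P = idm (P 𝟙).
Proof. apply (hom_to_terminal_eq sc P1). Qed.

(** The unit law of [nabla] with [eta] moved across as [eps], so that the counit law of [delta] can
    be applied next. *)
Lemma nabla_runit_eps (A : C) :
  fmap P (fwd (runit A)) \o nabla P A 𝟙
  = fwd (runit (P A)) \o (idm (P A) ⊗₁ eps P).
Proof.
rewrite <- (nabla_runit (bi_lax P) A), <- !comp_assoc, tens_map_id_comp.
fold (eta P).
now rewrite eta_eps, tens_id, comp_idr.
Qed.

Lemma nabla_lunit_eps (B : C) :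
  fmap P (fwd (lunit B)) \o nabla P 𝟙 B
  = fwd (lunit (P B)) \o (eps P ⊗₁ idm (P B)).
Proof.
rewrite <- (nabla_lunit (bi_lax P) B), <- !comp_assoc, tens_map_comp_id.
fold (eta P).
now rewrite eta_eps, tens_id, comp_idr.
Qed.

Lemma delta_nabla_units (A B : C) :
  delta P (A ⊗ 𝟙) (𝟙 ⊗ B) \o nabla P (A ⊗ 𝟙) (𝟙 ⊗ B)
  = (nabla P A 𝟙 ⊗₁ nabla P 𝟙 B) \o (delta P A 𝟙 ⊗₁ delta P 𝟙 B).
Proof.
pose proof (delta_nabla P A 𝟙 𝟙 B) as H.
(* [P1] selects the interchange on the right, with middle objects [P 𝟙]; the identity isomorphism of
   [𝟙] then selects the one under [fmap]. *)
rewrite (interchange_terminal P1) in H.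
rewrite (interchange_terminal (Iso (comp_idl (idm 𝟙)) (comp_idl (idm 𝟙)))) in H.
now rewrite fmap_id, !comp_idr in H.
Qed.

Lemma fmap_fwd_inv (X Y : C) (i : X ≅ Y) :
  fmap P (fwd i) \o fmap P (inv i) = idm (P Y).
Proof. now rewrite <- fmap_comp, fwd_inv, fmap_id. Qed.

Lemma delta_nabla_id (A B : C) :
  delta P A B \o nabla P A B = idm (P A ⊗ P B).
Proof.
(* Naturality carries the unitors past [nabla] and [delta], reducing to the objects [A ⊗ 𝟙] and
   [𝟙 ⊗ B]. *)
assert (K : delta P A B \o nabla P A B
            \o (fmap P (fwd (runit A)) ⊗₁ fmap P (fwd (lunit B)))
            = fmap P (fwd (runit A)) ⊗₁ fmap P (fwd (lunit B))).
{ unfold nabla, delta.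
  rewrite <- comp_assoc, nabla_nat, comp_assoc, delta_nat, <- comp_assoc.
  fold (nabla P (A ⊗ 𝟙) (𝟙 ⊗ B)); fold (delta P (A ⊗ 𝟙) (𝟙 ⊗ B)).
  rewrite delta_nabla_units, comp_assoc, <- !tens_comp.
  rewrite nabla_runit_eps, nabla_lunit_eps.
  unfold eps, delta.
  now rewrite delta_runit, delta_lunit. }
(* The unitor map in [K] has a right inverse, so it can be cancelled. *)
rewrite <- (comp_idr (delta P A B \o nabla P A B)).
rewrite <- tens_id, <- (fmap_fwd_inv (runit A)), <- (fmap_fwd_inv (lunit B)).
now rewrite tens_comp, comp_assoc, K.
Qed.

Lemma independent_law_tensor (A B : C) (a : law P A) (b : law P B) :
  independent P A B (law_tensor a b).
Proof.
unfold independent, law_tensor.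
rewrite <- (comp_assoc (nabla P A B)), (comp_assoc (delta P A B)).
now rewrite (comp_assoc (delta P A B)), delta_nabla_id, comp_idl, comp_assoc.
Qed.

Lemma fmap_law_tensor (A A' B B' : C) (f : A ~> A') (g : B ~> B')
    (a : law P A) (b : law P B) :
  fmap P (f ⊗₁ g) \o law_tensor a b
  = law_tensor (P := P) (fmap P f \o a : law P A') (fmap P g \o b : law P B').
Proof.
unfold law_tensor, nabla.
now rewrite !comp_assoc, <- nabla_nat, tens_comp, !comp_assoc.
Qed.

End BimonoidalFunctor.

Theorem proposition4p3 (C : symmetric_category) (sc : semicartesian C)
    (P : bimonoidal_functor C) (P1 : P 𝟙 ≅ 𝟙) (W X Y Z : C)
    (r : law P (W ⊗ X)) (s : law P (Y ⊗ Z)) :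
  independent P W Y (forget_XZ sc (law_tensor r s))
  /\ independent P X Z (forget_WY sc (law_tensor r s)).
Proof.
unfold forget_XZ, forget_WY.
(* Each forgetting map is a single tensor of two maps, so each marginal is the [law_tensor] of a
   marginal of [r] and one of [s]. *)
rewrite <- !tens_comp, !fmap_law_tensor.
split; apply (independent_law_tensor sc P1).
Qed.
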